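(* Let $M \subseteq \mathbb{R}^k$ be non-empty and closed and let $n, d \ge 0$ be integers. Then $$h(\mathbb{R}^n \times M) \le (n+1)\, h(M),$$ $$2^d\, h(M) \le h(M \times \mathbb{Z}^d),$$ $$h(\mathbb{R}^n \times \mathbb{Z}^d) = (n+1)\, 2^d.$$
   Context: For a non-empty set $M \subseteq \mathbb{R}^k$, a subset $C \subseteq M$ is called $M$-convex if $C = M \cap K$ for some convex set $K \subseteq \mathbb{R}^k$ (the empty set is $M$-convex). The Helly number $h(M)$ is the minimal integer $h \ge 0$ such that: every finite collection $C_1,\ldots,C_m$ ($m \ge h$) of $M$-convex sets, for which every sub-collection of $h$ elements has non-empty intersection, satisfies $C_1 \cap \cdots \cap C_m \ne \emptyset$. Collections are indexed families; the intersection of the empty sub-collection is $M$. If no such $h$ exists, $h(M) := \infty$ (with the usual arithmetic conventions for $\infty$). The sets $\mathbb{R}^n \times M$, $M \times \mathbb{Z}^d$ and $\mathbb{R}^n \times \mathbb{Z}^d$ are regarded as subsets of $\mathbb{R}^{n+k}$, $\mathbb{R}^{k+d}$ and $\mathbb{R}^{n+d}$, respectively. *)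

(* Defs.v *)
From HB Require Import structures.
From mathcomp Require Import all_boot all_order all_algebra.
From mathcomp Require Import all_classical all_reals all_analysis.

Set Implicit Arguments.
Unset Strict Implicit.
Unset Printing Implicit Defensive.

Import Order.TTheory GRing.Theory Num.Theory.
Import numFieldNormedType.Exports.

Local Open Scope classical_set_scope.
Local Open Scope ring_scope.

Section helly.
Context {R : realType}.

Definition rel_convex k (M C : set 'rV[R]_k) : Prop :=
  exists K : set 'rV[R]_k, convex_set K /\ C = M `&` K.

(* The intersection with M changes nothing when I is non-empty and the C i are
   subsets of M; it makes the intersection of the empty sub-collection M. *)
Definition subfamily_cap k (M : set 'rV[R]_k) m (C : 'I_m -> set 'rV[R]_k)
    (I : {set 'I_m}) : set 'rV[R]_k :=
  M `&` \bigcap_(i in [set` I]) C i.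

Definition helly_property k (M : set 'rV[R]_k) (h : nat) : Prop :=
  forall (m : nat) (C : 'I_m -> set 'rV[R]_k),
    (h <= m)%N ->
    (forall i, rel_convex M (C i)) ->
    (forall I : {set 'I_m}, #|I| = h -> subfamily_cap M C I !=set0) ->
    subfamily_cap M C [set: 'I_m]%SET !=set0.

Definition helly_number k (M : set 'rV[R]_k) : \bar R :=
  if pselect (exists h : nat, `[< helly_property M h >]) is left ex
  then (ex_minn ex)%:R%:E else +oo%E.

Definition rV_prod p q (A : set 'rV[R]_p) (B : set 'rV[R]_q) :
    set 'rV[R]_(p + q) :=
  [set x : 'rV[R]_(p + q) | A (lsubmx x) /\ B (rsubmx x)].

End helly.

Definition int_lattice (R : realType) d : set 'rV[R]_d :=
  [set x : 'rV[R]_d | forall j, x ord0 j \is a Num.int].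
Arguments int_lattice : clear implicits.

(* Main.v *)
(* The Helly number of M is the largest size of a critical family: finitely many
   convex sets K_i with no common point in M such that, for every j, the K_i with
   i <> j do have a common point in M.

   Upper bound for R^n x M: the projections to R^k of the intersections of at most
   n+1 members have a common point y in M, since any h(M) of them involve at most
   (n+1) h(M) members; Helly's theorem in the fiber over y gives the rest.
   Lower bound for M x Z^d: put a copy of a critical family for M over each of the
   2^d vertices of the unit cube.
   Doignon's bound h(Z^d) <= 2^d: enlarge the K_i as much as possible within a
   finite box of lattice points; then the witnesses x_j (common to all K_i with
   i <> j) can be chosen so that the midpoint of x_j with any point of K_j remains
   in K_j. Two witnesses of the same parity would have a lattice midpoint common to
   all K_i. *)
Require Import Defs.
From mathcomp Require Import all_boot all_order all_algebra.
From mathcomp Require Import all_classical all_reals all_analysis.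
From mathcomp Require Import lra ring zify.
Import Order.TTheory GRing.Theory Num.Theory.
Import numFieldNormedType.Exports.
Local Open Scope classical_set_scope.
Local Open Scope ring_scope.

(** * Convex sets and weighted means *)

Lemma convex_setP (R : realType) (V : lmodType R) (K : set V) :
  convex_set K <->
  forall x y (t : R), K x -> K y -> 0 < t -> t < 1 -> K (t *: x + (1 - t) *: y).
Proof.
rewrite convex_setW; split=> [cK x y t Kx Ky t0 t1|cK x y t xK yK t0 t1].
  have /= := cK x y (mem_set Kx) (mem_set Ky) (Itv01 (ltW t0) (ltW t1)) t0 t1.
  by move/set_mem.
by apply/mem_set/cK => //; apply/set_mem.
Qed.

Lemma convex_set_sum (R : realType) (V : lmodType R) (K : set V) (T : finType)
    (P : pred T) (w : T -> R) (x : T -> V) :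
  convex_set K -> (forall t, P t -> 0 < w t) -> (forall t, P t -> K (x t)) ->
  0 < \sum_(t | P t) w t ->
  K ((\sum_(t | P t) w t)^-1 *: \sum_(t | P t) w t *: x t).
Proof.
move=> /convex_setP cK w0 Kx.
(* An empty sum cannot be normalised, so the invariant separates it from the sums of positive
   weight, which are multiples of a point of [K]. *)
pose Q (v : V) (W : R) :=
  (v = 0 /\ W = 0) \/ 0 < W /\ exists2 k, K k & v = W *: k.
have [[_ ->]|[W0 [k Kk ->]]] : Q (\sum_(t | P t) w t *: x t) (\sum_(t | P t) w t).
- apply: (big_ind2 Q) => [|v1 W1 v2 W2|t Pt]; first by left.
  + move=> [[-> ->]|[W10 [k1 Kk1 ->]]] [[-> ->]|[W20 [k2 Kk2 ->]]];
      rewrite ?add0r ?addr0.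
    * by left.
    * by right; split=> //; exists k2.
    * by right; split=> //; exists k1.
    * right; split; first exact: addr_gt0.
      have W0 : W1 + W2 != 0 by rewrite gt_eqF// addr_gt0.
      exists ((W1 / (W1 + W2)) *: k1 + (1 - W1 / (W1 + W2)) *: k2).
        apply: cK => //; first by rewrite divr_gt0// addr_gt0.
        by rewrite ltr_pdivrMr ?addr_gt0// mul1r ltrDl.
      rewrite scalerDr !scalerA; congr (_ *: _ + _ *: _); field => //.
  + by right; split; [exact: w0|exists (x t) => //; exact: Kx].
- by rewrite ltxx.
- by move=> _; rewrite scalerA mulVf ?scale1r ?gt_eqF.
Qed.

(** * The Helly property through critical families *)

Definition critical {R : realType} {k} (M : set 'rV[R]_k) {T : finType}
    (K : T -> set 'rV[R]_k) :=
  [/\ forall i, convex_set (K i),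
      forall x, M x -> exists i, ~ K i x
    & forall j, exists2 x, M x & forall i, i != j -> K i x].

(** A family with fewer than [h] members is one of its own small subfamilies; conversely, since
    [h <= m], a small subfamily can be padded to exactly [h] members. *)
Lemma helly_propertyP (R : realType) k (M : set 'rV[R]_k) h :
  helly_property M h <->
  forall (T : finType) (K : T -> set 'rV[R]_k),
    (forall i, convex_set (K i)) ->
    (forall I : {set T}, (#|I| <= h)%N ->
       exists2 x, M x & forall i, i \in I -> K i x) ->
    exists2 x, M x & forall i, K i x.
Proof.
split=> [hM T K cK KI|hM m C hm cC CI].
- have [hT|/ltnW Th] := leqP h #|T|; last first.
    have [x Mx Kx] := KI [set: T]%SET (leq_trans (max_card _) Th).
    by exists x => // i; apply: Kx; rewrite inE.
  have [|I Ih|x [Mx Cx]] := hM #|T| (fun i => M `&` K (enum_val i)) hT.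
  + by move=> i; exists (K (enum_val i)).
  + have [|x Mx Kx] := KI [set enum_val i | i in I]%SET.
      by rewrite -Ih leq_imset_card.
    exists x; split=> // i /= iI; split=> //; apply: Kx.
    by apply/imsetP; exists i.
  + exists x => // i; rewrite -(enum_rankK i).
    by have [|] := Cx (enum_rank i); rewrite /= ?inE.
- have [K KC] := choice cC.
  have [||x Mx Kx] := hM 'I_m K.
  + by move=> i; have [] := KC i.
  + move=> I Ih.
    have [J IJ Jh] : exists2 J : {set 'I_m}, I \subset J & #|J| = h.
      have : (h - #|I| <= #|~: I|)%N.
        by rewrite [X in (_ <= X)%N]cardsCs finset.setCK card_ord leq_sub2r.
      case/card_geqP=> s [us ss sI]; exists (I :|: [set x in s])%SET.
        exact: finset.subsetUl.
      rewrite cardsU (_ : #|I :&: _| = 0%N) ?subn0 ?cardsE.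
        by rewrite (card_uniqP us) ss subnKC.
      apply: eq_card0 => i; rewrite !inE.
      by apply/negP => /andP[iI]; rewrite finset.in_set => /(sI _); rewrite inE iI.
    have [x [Mx Cx]] := CI J Jh.
    exists x => // i iI; have := Cx i (fintype.subsetP IJ _ iI).
    by have [_ ->] := KC i; case.
  + exists x; split=> // i _; have [_ ->] := KC i; split=> //.
Qed.

(** An inclusion-minimal subfamily without a common point in [M] is critical. Conversely, any [h]
    members of a larger critical family miss some index [j], whose witness is common to them. *)
Lemma helly_property_critical (R : realType) k (M : set 'rV[R]_k) h :
  helly_property M h <->
  forall (T : finType) (K : T -> set 'rV[R]_k), critical M K -> (#|T| <= h)%N.
Proof.
rewrite helly_propertyP; split=> [hM T K [cK K0 Kj]|hM T K cK KI].
- rewrite leqNgt; apply/negP => hT.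
  have [I Ih|x Mx Kx] := hM T K cK.
    have /fintype.subsetPn[j _ jI] : ~~ ([set: T]%SET \subset I).
      apply: contraL hT => /subset_leq_card.
      by rewrite cardsT -leqNgt => /leq_trans; apply.
    have [x Mx Kx] := Kj j; exists x => // i iI; apply: Kx.
    by apply: contraNneq jI => <-.
  by have [i] := K0 x Mx; exact.
- apply: contrapT => noK.
  pose P (A : {set T}) := `[< ~ exists2 x, M x & forall i, i \in A -> K i x >].
  have [A /minsetP[/asboolP PA minA] _] : {A | minset P A & A \subset [set: T]%SET}.
    apply: minset_exists; apply/asboolP => -[x Mx Kx]; apply: noK.
    by exists x => // i; apply: Kx; rewrite inE.
  apply: (PA); apply: KI.
  have -> : #|A| = #|{: {i | i \in A}}|.
    by rewrite card_sig; apply: eq_card => i; rewrite inE.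
  apply: (hM _ (fun i => K (val i))); split=> [i|x Mx|j].
  + exact: cK.
  + apply: contrapT => /forallNP Kx; apply: PA; exists x => // i iA.
    by have /contrapT := Kx (exist _ i iA).
  + apply: contrapT => noj.
    have := minA (A :\ val j)%SET; rewrite subsetDl => /(_ _ isT) AE.
    have : val j \in (A :\ val j)%SET.
      rewrite AE ?(valP j)//; apply/asboolP => -[x Mx Kx]; apply: noj.
      exists x => // i ij; apply: Kx.
      by rewrite !inE (valP i) andbT.
    by rewrite !inE eqxx.
Qed.

(** * Helly's theorem in R^n and its sharpness *)

(** The rows [(1, x t)] live in dimension n + 1, so they are linearly dependent; the leading 1 makes
    the coefficients sum to zero. *)
Lemma affine_dependence (F : fieldType) n (T : finType) (x : T -> 'rV[F]_n) :
  (n.+1 < #|T|)%N ->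
  exists l : T -> F,
    [/\ exists t, l t != 0, \sum_t l t = 0 & \sum_t l t *: x t = 0].
Proof.
move=> nT; pose f t : 'rV[F]_(1 + n) := row_mx 1%:M (x t).
pose A := \matrix_(i < #|T|) f (enum_val i).
have kA : nz_row (kermx A) != 0.
  rewrite nz_row_eq0 -mxrank_eq0 mxrank_ker subn_eq0 -ltnNge.
  exact: leq_ltn_trans (rank_leq_col A) nT.
have /sub_kermxP := nz_row_sub (kermx A).
have [i li] := rV0Pn _ kA.
rewrite mulmx_sum_row (reindex enum_rank) /=; last exact/onW_bij/enum_rank_bij.
pose l t := nz_row (kermx A) 0 (enum_rank t).
rewrite (eq_bigr (fun t => l t *: f t)) => [lf|t _]; last first.
  by rewrite rowK enum_rankK.
exists l; split.
- by exists (enum_val i); rewrite /l enum_valK.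
- have := congr1 (fun v => lsubmx v 0 0) lf; rewrite linear_sum summxE !mxE.
  move=> l0; rewrite -[RHS]l0; apply: eq_bigr => t _.
  by rewrite linearZ /= row_mxKl !mxE eqxx mulr1.
- have := congr1 rsubmx lf; rewrite linear_sum linear0 => l0.
  by rewrite -[RHS]l0; apply: eq_bigr => t _; rewrite linearZ /= row_mxKr.
Qed.

(* Radon's theorem: split an affine dependence of the witnesses by sign. *)
Lemma helly_setT (R : realType) n : helly_property [set: 'rV[R]_n] n.+1.
Proof.
apply/helly_property_critical => T K [cK K0 Kj].
have /choice[x Kx] j : exists x, forall i, i != j -> K i x.
  by have [x _ Kx] := Kj j; exists x.
rewrite leqNgt; apply/negP => /(affine_dependence _ _ _ x)[l [[t0 lt0] l0 lx0]].
pose P t := 0 < l t; pose N t := l t < 0.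
have split (V : lmodType R) (F : T -> V) : (forall t, l t = 0 -> F t = 0) ->
    \sum_t F t = \sum_(t | P t) F t + \sum_(t | N t) F t.
  move=> F0; rewrite (bigID P) /=; congr (_ + _).
  rewrite (bigID N) /= [X in _ + X]big1 ?addr0.
    by apply: eq_bigl => t; rewrite /P /N; case: ltgtP.
  by move=> t; rewrite /P /N; case: ltgtP => // /esym/F0.
have lPN : \sum_(t | P t) l t = \sum_(t | N t) - l t.
  by apply/eqP; rewrite sumrN -addr_eq0 -(split R^o l) // l0.
have xPN : \sum_(t | P t) l t *: x t = \sum_(t | N t) - l t *: x t.
  apply/eqP; under [eqbRHS]eq_bigr do rewrite scaleNr.
  by rewrite sumrN -addr_eq0 -split ?lx0 // => t ->; rewrite scale0r.
have lP : 0 < \sum_(t | P t) l t.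
  have := lt0; rewrite neq_lt => /orP[lN|lP].
    rewrite lPN (bigD1 t0) //= ltr_wpDr ?oppr_gt0//.
    by apply: sumr_ge0 => t /andP[/ltW]; rewrite oppr_ge0.
  by rewrite (bigD1 t0) //= ltr_wpDr// sumr_ge0// => t /andP[/ltW].
(* The Radon point: by [lPN] and [xPN] it is a weighted mean of the witnesses of either sign. For
   each [i], the sign class that does not contain [i] has all its witnesses in [K i]. *)
pose z := (\sum_(t | P t) l t)^-1 *: \sum_(t | P t) l t *: x t.
have [//|i] := K0 z; apply.
have [Pi|NPi] := boolP (P i).
- rewrite /z xPN; move: (lP); rewrite lPN => lN.
  apply: convex_set_sum => // t.
    by rewrite oppr_gt0.
  move=> Nt; apply: Kx; apply: contraTneq Nt => <-.
  by rewrite /N -leNgt ltW.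
- by apply: convex_set_sum => // t Pt; apply: Kx; apply: contraNneq NPi => ->.
Qed.


(** These n + 1 half-spaces make the constant of Helly's theorem sharp: minus a basis vector
    violates only the matching coordinate condition, and the origin violates only the condition on
    the sum. *)
Lemma critical_simplex (R : realType) n :
  critical [set: 'rV[R]_n] (fun o : option 'I_n =>
    if o is Some j then [set x | 0 <= x 0 j] else [set x | \sum_j x 0 j < 0]).
Proof.
split=> [[j|]|x _|[j|]].
- apply/convex_setP => x y t /= x0 y0 t0 t1; rewrite !mxE.
  by rewrite addr_ge0// mulr_ge0// ?subr_ge0 ltW.
- apply/convex_setP => x y t /= x0 y0 t0 t1.
  under eq_bigr do rewrite !mxE.
  rewrite big_split /= -!mulr_sumr -[ltRHS]addr0 ltrD//.
    by rewrite pmulr_rlt0.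
  by rewrite pmulr_rlt0// subr_gt0.
- have [x0|x0] := ltP (\sum_j x 0 j) 0; last by exists None => /=; rewrite ltNge x0.
  have [j xj] : exists j, x 0 j < 0.
    apply: contrapT => /forallNP xN; move: x0; rewrite ltNge sumr_ge0// => j _.
    by rewrite leNgt; apply/negP/xN.
  by exists (Some j) => /=; rewrite leNgt xj.
- exists (- delta_mx 0 j) => // -[i|] /=.
    rewrite (inj_eq Some_inj) !mxE eqxx => /negPf ->.
    by rewrite oppr0.
  move=> _; rewrite (bigD1 j) //= big1 ?addr0 => [|i /negPf ij].
    by rewrite !mxE !eqxx oppr_lt0 ltr01.
  by rewrite !mxE eqxx ij oppr0.
- by exists 0 => // -[i|//] _ /=; rewrite mxE.
Qed.

(** * Upper bound for R^n x M *)

Lemma helly_property_prod (R : realType) n k (M : set 'rV[R]_k) h :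
  helly_property M h ->
  helly_property (rV_prod [set: 'rV[R]_n] M) (n.+1 * h).
Proof.
move=> /helly_propertyP hM; apply/helly_propertyP => T K cK KI.
pose fiber (y : 'rV[R]_k) i : set 'rV[R]_n := [set z | K i (row_mx z y)].
(* For [I] with at most n + 1 elements this is the projection of an intersection; larger [I] give
   the whole space, so that all of [{set T}] can serve as index type. *)
pose D (I : {set T}) : set 'rV[R]_k :=
  [set y | (#|I| <= n.+1)%N -> exists z, forall i, i \in I -> fiber y i z].
have [I|J Jh|y My yD] := hM {set T} D.
- apply/convex_setP => y1 y2 t yI1 yI2 t0 t1 In.
  have [z1 z1K] := yI1 In; have [z2 z2K] := yI2 In.
  exists (t *: z1 + (1 - t) *: z2) => i iI; rewrite /fiber /=.
  rewrite -add_row_mx -!scale_row_mx.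
  by have /convex_setP := cK i; apply; [exact: z1K|exact: z2K| |].
(* The union of at most [h] index sets, each of size at most n + 1; a common point of the [K i] with
   [i] in [U] projects into every [D I] with [I] in [J]. *)
- pose U := finset.cover [set I in J | (#|I| <= n.+1)%N]%SET.
  have [|x [_ Mx] Kx] := KI U.
    rewrite (leq_trans (leq_card_cover _))//.
    rewrite (leq_trans (n := \sum_(I in [set I in J | (#|I| <= n.+1)%N]%SET) n.+1))//.
      by apply: leq_sum => I; rewrite finset.inE => /andP[].
    rewrite sum_nat_const mulnC leq_mul2l/= (leq_trans _ Jh)//.
    by apply/subset_leq_card/fintype.subsetP => I; rewrite finset.inE => /andP[].
  exists (rsubmx x) => // I IJ In; exists (lsubmx x) => i iI.
  rewrite /fiber /= hsubmxK; apply: Kx; apply/bigcupP; exists I => //.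
  by rewrite finset.inE IJ.
- have /helly_propertyP hR := helly_setT R n.
  have [i|I In|z _ zK] := hR T (fiber y).
  + apply/convex_setP => z1 z2 t /= z1K z2K t0 t1; rewrite /fiber /=.
    have -> : y = t *: y + (1 - t) *: y by rewrite -scalerDl addrC subrK scale1r.
    rewrite -add_row_mx -!scale_row_mx.
    by have /convex_setP := cK i; apply.
  + by have [z zK] := yD I In; exists z.
  + by exists (row_mx z y) => //; rewrite /rV_prod /= row_mxKr.
Qed.

(** * Lower bound for M x Z^d *)

Lemma convex_comb_eq_vertex (R : realType) (t a b : R) (e : bool) :
  0 < t < 1 -> 0 <= a <= 1 -> 0 <= b <= 1 -> t * a + (1 - t) * b = e%:R ->
  a = e%:R /\ b = e%:R.
Proof. by case: e => /= /andP[? ?] /andP[? ?] /andP[? ?] ?; split; nra. Qed.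

(* One copy of the family in each layer [M x {e}] with [e] a vertex of the unit
   cube; the copies do not interact because [e] is an extreme point. *)
Lemma critical_prod_lattice (R : realType) k d (M : set 'rV[R]_k) (T : finType)
    (K : T -> set 'rV[R]_k) :
  M !=set0 -> critical M K ->
  critical (rV_prod M (int_lattice R d))
    (fun ie : T * {ffun 'I_d -> bool} =>
      [set x | (forall j, 0 <= rsubmx x 0 j <= 1) /\
        ((forall j, rsubmx x 0 j = (ie.2 j)%:R) -> K ie.1 (lsubmx x))]).
Proof.
move=> [x0 Mx0] [cK K0 Kj]; split=> [[i e]|x [Mx xZ]|[i e]].
- apply/convex_setP => x y t [x01 Kx] [y01 Ky] t0 t1 /=.
  have rE j : rsubmx (t *: x + (1 - t) *: y) 0 j =
      t * rsubmx x 0 j + (1 - t) * rsubmx y 0 j by rewrite !mxE.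
  split=> [j|xye].
    by rewrite rE; move: (x01 j) (y01 j) => /andP[? ?] /andP[? ?]; nra.
  have xyE j : rsubmx x 0 j = (e j)%:R /\ rsubmx y 0 j = (e j)%:R.
    by apply: (@convex_comb_eq_vertex _ t); rewrite ?t0 ?t1 ?x01 ?y01 -?rE.
  rewrite linearD !linearZ /=; have /convex_setP := cK i; apply => //.
    by apply: Kx => j; case: (xyE j).
  by apply: Ky => j; case: (xyE j).
- have [[j xj]|/forallNP x01] :=
    pselect (exists j, ~ (0 <= rsubmx x 0 j <= 1)).
    (* Outside the cube every member excludes [x]; the point [x0] only serves to show that the index
       type is inhabited. *)
    have [i _] := K0 _ Mx0.
    by exists (i, [ffun=> false]) => -[/(_ j)].
  have [i Kx] := K0 _ Mx.
  (* An integer in [0, 1] is 0 or 1, so this is the vertex of the layer containing [x]. *)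
  exists (i, [ffun j => rsubmx x 0 j == 1]) => /= -[_ /(_ _)/Kx]; apply.
  move=> j; rewrite ffunE; have /contrapT/andP[] := x01 j.
  have /intrP[z ->] := xZ j; rewrite ler0z (ler_int _ _ 1) => z0 z1.
  by rewrite (eqr_int _ z 1); move: z z0 z1 => [[|[|z]]|z].
- have [x Mx Kx] := Kj i.
  exists (row_mx x (\row_j (e j)%:R)).
    split; rewrite ?row_mxKl ?row_mxKr // => j.
    by rewrite mxE; exact: natr_int.
  move=> [i' e'] /= ie; rewrite row_mxKl row_mxKr; split=> [j|ee'].
    by rewrite mxE; case: (e j); rewrite /= ?ler01 !lexx.
  apply: Kx; apply: contraNneq ie => ->; apply/eqP; congr pair.
  apply/ffunP => j; move: (ee' j); rewrite mxE => /eqP; rewrite eqr_nat.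
  by case: (e j) (e' j) => -[].
Qed.

(** * Cones and Doignon's bound *)

(* [conv (K `|` [set x]) `\ x] when [x] is outside the convex set [K]. *)
Definition cone_at {R : realType} {k} (K : set 'rV[R]_k) (x : 'rV[R]_k) :=
  [set y | exists z (t : R), [/\ K z, 0 <= t, t < 1 & y = t *: x + (1 - t) *: z]].

Lemma sub_cone_at (R : realType) k (K : set 'rV[R]_k) x : K `<=` cone_at K x.
Proof. by move=> y Ky; exists y, 0; rewrite scale0r subr0 scale1r add0r ltr01. Qed.

Lemma convex_cone_at (R : realType) k (K : set 'rV[R]_k) x :
  convex_set K -> convex_set (cone_at K x).
Proof.
move=> /convex_setP cK; apply/convex_setP => _ _ s
  [y [t [Ky t0 t1 ->]]] [y' [t' [Ky' t0' t1' ->]]] s0 s1.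
(* The total weight on [x]; what remains, divided by [1 - u], is a convex combination of [y] and
   [y']. *)
pose u := s * t + (1 - s) * t'.
have u0 : 0 <= u by rewrite /u; nra.
have v0 : 0 < 1 - u.
  have -> : 1 - u = s * (1 - t) + (1 - s) * (1 - t') by rewrite /u; ring.
  by rewrite addr_gt0// mulr_gt0// subr_gt0.
exists ((s * (1 - t) / (1 - u)) *: y + (1 - s * (1 - t) / (1 - u)) *: y'), u.
split=> //.
- apply: cK => //; first by rewrite divr_gt0// mulr_gt0// subr_gt0.
  rewrite ltr_pdivrMr// mul1r -subr_gt0 (_ : _ - _ = (1 - s) * (1 - t')).
    by rewrite mulr_gt0// subr_gt0.
  by rewrite /u; ring.
- by rewrite -subr_gt0.
- rewrite !scalerDr !scalerA addrACA -scalerDl -/u; congr (_ + (_ *: _ + _ *: _)).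
    by field; rewrite gt_eqF.
  by rewrite /u; field; rewrite -/u gt_eqF.
Qed.

Lemma notin_cone_at (R : realType) k (K : set 'rV[R]_k) x : ~ K x -> ~ cone_at K x x.
Proof.
move=> Kx [y [t [Ky t0 t1 xE]]]; apply: Kx; suff -> : x = y by [].
have t10 : 1 - t != 0 by rewrite subr_eq0 gt_eqF.
apply: (scalerI t10); rewrite scalerBl scale1r {1}xE.
by rewrite addrC addKr.
Qed.

(** The cone at [x] is convex and contains both [y] and [K], hence all segments from [y] to [K]. *)
Lemma cone_at_trans (R : realType) k (K : set 'rV[R]_k) x y :
  convex_set K -> cone_at K x y -> cone_at K y `<=` cone_at K x.
Proof.
move=> cK xy w [z [t [Kz t0 t1 ->]]].
have [->|t_neq0] := eqVneq t 0.
  by rewrite scale0r add0r subr0 scale1r; exact: sub_cone_at.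
have /convex_setP := convex_cone_at _ _ _ x cK; apply => //.
- exact: sub_cone_at.
- by rewrite lt_neqAle eq_sym t_neq0.
Qed.

Lemma midpoint_cone_at (R : realType) k (K : set 'rV[R]_k) x y :
  cone_at K x y -> cone_at K x (2^-1 *: (x + y)).
Proof.
move=> [z [t [Kz t0 t1 ->]]]; exists z, ((1 + t) / 2); split=> //.
- by rewrite divr_ge0// addr_ge0.
- by rewrite ltr_pdivrMr// mul1r; lra.
- rewrite addrA -{1}[x]scale1r -scalerDl scalerDr !scalerA.
  by congr (_ *: _ + _ *: _); field.
Qed.

(* A minimizer [x] of the number of points of [S] in [cone_at K x] works: any [y]
   in the intersection would have a smaller cone, as it is not in its own. *)
Lemma exists_free_cone (R : realType) k (B : finType) (f : B -> 'rV[R]_k)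
    (K : set 'rV[R]_k) (S : pred B) (b0 : B) :
  convex_set K -> S b0 -> (forall b, S b -> ~ K (f b)) ->
  exists2 b, S b & forall c, S c -> ~ cone_at K (f b) (f c).
Proof.
move=> cK Sb0 SK.
pose F b := [set c | S c && `[< cone_at K (f b) (f c) >]]%SET.
have [b Sb bmin] := arg_minnP (fun b => #|F b|) Sb0.
exists b => // c Sc bc; have := bmin c Sc; rewrite leqNgt => /negP; apply.
apply/proper_card/properP; split.
  apply/fintype.subsetP => a; rewrite !finset.inE => /andP[-> /asboolP ca].
  by apply/asboolP; exact: cone_at_trans ca.
exists c; rewrite finset.inE Sc /=; first exact/asboolP.
by apply/asboolP; apply: notin_cone_at; exact: SK.
Qed.

(* Induction on the number of points of [f] outside the [K i]. If some witness
   cone of [exists_free_cone] contains a new point, it replaces [K i]. Otherwise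
   no two witnesses have the same parity, as their midpoint would be common. *)
Lemma critical_parity (R : realType) k (B P : finType) (f : B -> 'rV[R]_k)
    (p : B -> P) (T : finType) (K : T -> set 'rV[R]_k) :
  (forall b c, p b = p c -> exists a, f a = 2^-1 *: (f b + f c)) ->
  critical (range f) K -> (#|T| <= #|P|)%N.
Proof.
move=> mid.
have [n] := ubnP (\sum_i #|[set b | `[< ~ K i (f b) >]]%SET|)%N.
elim: n K => // n IH K; rewrite ltnS => Kn critK; have [cK K0 Kj] := critK.
(* The candidate witnesses for [j]; by criticality none of them lies in [K j]. *)
pose S j b := `[< forall i, i != j -> K i (f b) >].
have SK j b : S j b -> ~ K j (f b).
  move=> /asboolP Sb Kb; have [|i] := K0 (f b); first by exists b.
  by have [->|/Sb] := eqVneq i j.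
have /choice[x xP] j :
    exists b, S j b /\ forall c, S j c -> ~ cone_at (K j) (f b) (f c).
  have [_ [b0 _ <-] Sb0] := Kj j.
  have [|b Sb bcone] := @exists_free_cone _ _ _ f (K j) (S j) b0 (cK j) _ (SK j).
    exact/asboolP.
  by exists b.
have [[j [b [jb Kjb]]]|closed] :=
    pselect (exists j b, cone_at (K j) (f (x j)) (f b) /\ ~ K j (f b)).
  pose K' i := if i == j then cone_at (K j) (f (x j)) else K i.
  have KK' i : K i `<=` K' i.
    by rewrite /K' => y; case: eqP => [->|//]; exact: sub_cone_at.
  apply: (IH K'); last first.
    split=> [i|_ [c _ <-]|i].
    - by rewrite /K'; case: eqP => // _; exact: convex_cone_at.
    (* A point common to all [K'] would be a candidate witness for [j] inside the cone at [x j],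
       against the choice of [x j]. *)
    - apply: contrapT => /forallNP K'c.
      have {}K'c i : K' i (f c) by apply: contrapT.
      have /(proj2 (xP j)) : S j c.
        by apply/asboolP => i /negPf ij; have := K'c i; rewrite /K' ij.
      by have := K'c j; rewrite /K' eqxx.
    - by have [y My Ky] := Kj i; exists y => // i' /Ky/KK'.
  apply: leq_trans Kn; rewrite (bigD1 j) //= [ltnRHS](bigD1 j) //= -addSn leq_add//.
    apply/proper_card/properP; split.
      apply/fintype.subsetP => c; rewrite !finset.inE => /asboolP K'c.
      by apply/asboolP => /KK'.
    exists b; rewrite finset.inE; first exact/asboolP.
    by apply/asboolP => /(_ _); rewrite /K' eqxx; exact.
  apply: leq_sum => i _; apply/subset_leq_card/fintype.subsetP => c.
  by rewrite !finset.inE => /asboolP K'c; apply/asboolP => /KK'.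
rewrite leqNgt; apply/negP => PT.
have /injectivePn[j [i ij pij]] : ~~ injectiveb (p \o x).
  by apply/negP => /injectiveP/leq_card; rewrite leqNgt PT.
have [a aE] := mid _ _ pij.
(* The witness [x i] lies in [K j] and [x j] in [K i], so the midpoint lies in both cones, and
   [closed] puts it into [K j] and [K i]. Any other [K l] contains both witnesses and is convex. *)
have half : K j (f a) /\ K i (f a).
  have xK i' j' : i' != j' -> K i' (f (x j')).
    by case: (xP j') => /asboolP /(_ i').
  have closed' j' b : cone_at (K j') (f (x j')) (f b) -> K j' (f b).
    by move=> ?; apply: contrapT => ?; apply: closed; exists j', b.
  split; apply: closed'; rewrite aE; last rewrite addrC.
    by apply: midpoint_cone_at; apply: sub_cone_at; exact: xK.
  by apply: midpoint_cone_at; apply: sub_cone_at; apply: xK; rewrite eq_sym.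
have [|l] := K0 (f a); first by exists a.
have [->|lj] := eqVneq l j; first by case: half.
have [->|li] := eqVneq l i; first by case: half.
apply; have xK j' : l != j' -> K l (f (x j')).
  by case: (xP j') => /asboolP /(_ l).
have -> : f a = 2^-1 *: f (x j) + (1 - 2^-1) *: f (x i).
  by rewrite aE scalerDr; congr (_ + _ *: _); field.
have /convex_setP := cK l; apply; [exact: xK|exact: xK| |]; lra.
Qed.

Lemma helly_int_lattice (R : realType) d : helly_property (int_lattice R d) (2 ^ d).
Proof.
apply/helly_property_critical => T K [cK K0 Kj].
have /choice[x xP] j : exists x, int_lattice R d x /\ forall i, i != j -> K i x.
  by have [x] := Kj j; exists x.
(* A bound for all coordinates of the chosen witnesses: the family stays critical on the box
   [-N, N]^d, which [f] enumerates. *)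
pose N := (\sum_t \sum_j `|Num.floor (x t ord0 j)|)%N.
pose f (b : {ffun 'I_d -> 'I_(2 * N).+1}) : 'rV[R]_d :=
  \row_j ((b j)%:R - N%:R).
pose p (b : {ffun 'I_d -> 'I_(2 * N).+1}) := [ffun j => odd (b j)].
have -> : (2 ^ d = #|{ffun 'I_d -> bool}|)%N by rewrite card_ffun card_bool card_ord.
apply: (critical_parity R d _ _ f p _ K).
  (* The shift by [N] commutes with taking midpoints, and coordinates of equal parity have an
     integer mean, which stays in the box. *)
  move=> b c bc; exists [ffun j => inord ((b j + c j)./2)].
  apply/rowP => j; rewrite !mxE ffunE inordK; last first.
    by rewrite ltnS; have := ltn_ord (b j); have := ltn_ord (c j); lia.
  have : ~~ odd (b j + c j).
    have := congr1 (fun q : {ffun _} => q j) bc.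
    by rewrite !ffunE oddD => ->; rewrite addbb.
  move=> /even_halfK; rewrite -muln2 => /(congr1 (fun n => n%:R : R)).
  rewrite natrM natrD; lra.
split=> // [_ [b _ <-]|j].
  by apply: K0 => j; rewrite mxE rpredB// natr_int.
have [xZ Kx] := xP j; exists (x j) => //.
exists [ffun i => inord (absz (Num.floor (x j ord0 i) + N%:Z))] => //.
apply/rowP => i; rewrite !mxE ffunE.
have xE : (Num.floor (x j 0 i))%:~R = x j 0 i by apply/eqP; rewrite -intrEfloor.
have NE : (`|Num.floor (x j ord0 i)| <= N)%N.
  by rewrite /N (bigD1 j) //= (bigD1 i) //= -addnA leq_addr.
rewrite inordK; last by lia.
rewrite -{2}xE natr_absz ger0_norm; last by lia.
by rewrite intrD addrK.
Qed.

(** * Helly numbers and the three bounds *)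

Lemma helly_number_le (R : realType) k (M : set 'rV[R]_k) h :
  helly_property M h -> (helly_number M <= h%:R%:E)%E.
Proof.
move=> hM; rewrite /helly_number; case: pselect => [ex|[]]; last first.
  by exists h; exact/asboolP.
by case: ex_minnP => h' _ /(_ h); rewrite lee_fin ler_nat; apply; exact/asboolP.
Qed.

(** Only the finite case carries data: wherever the value +oo occurs below, the inequality to prove
    is trivial. *)
Variant helly_number_spec (R : realType) k (M : set 'rV[R]_k) : \bar R -> Prop :=
  | HellyFinite h of helly_property M h : helly_number_spec R k M h%:R%:E
  | HellyInfinite : helly_number_spec R k M +oo%E.

Lemma helly_numberP (R : realType) k (M : set 'rV[R]_k) :
  helly_number_spec R k M (helly_number M).
Proof.
rewrite /helly_number; case: pselect => [ex|_]; last exact: HellyInfinite.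
by case: ex_minnP => h /asboolP hM _; exact: HellyFinite.
Qed.

Theorem theorem1p1 (R : realType) (k : nat) (M : set 'rV[R]_k) (n d : nat)
    (M_neq0 : M !=set0) (M_closed : closed M) :
  [/\ (helly_number (rV_prod [set: 'rV[R]_n] M)
         <= n.+1%:R%:E * helly_number M)%E,
      ((2 ^ d)%:R%:E * helly_number M
         <= helly_number (rV_prod M (int_lattice R d)))%E
    & helly_number (rV_prod [set: 'rV[R]_n] (int_lattice R d))
        = (n.+1 * 2 ^ d)%:R%:E].
Proof.
split.
- case: (helly_numberP R k M) => [h hM|]; last first.
    by rewrite gt0_muley ?leey// lte_fin ltr0n.
  by rewrite -EFinM -natrM; exact/helly_number_le/helly_property_prod.
- case: (helly_numberP R (k + d) (rV_prod M (int_lattice R d))) => [h hMZ|];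
    last exact: leey.
  (* Every critical family for [M] has size at most h / 2^d, so the rounded-down quotient is a Helly
     bound for [M]. *)
  apply: (@le_trans _ _ ((2 ^ d)%:R%:E * (h %/ 2 ^ d)%:R%:E)%E).
    rewrite lee_pmul2l ?lte_fin ?ltr0n ?expn_gt0//.
    apply/helly_number_le/helly_property_critical => T K critK.
    have := critical_prod_lattice _ _ d _ _ _ M_neq0 critK.
    move/helly_property_critical: hMZ => /[apply].
    by rewrite card_prod card_ffun card_bool card_ord leq_divRL ?expn_gt0.
  by rewrite -EFinM -natrM lee_fin ler_nat mulnC leq_divM.
- apply/le_anti/andP; split.
    exact/helly_number_le/helly_property_prod/helly_int_lattice.
  have Rn_neq0 : [set: 'rV[R]_n] !=set0 by exists 0.
  (* Copies of the n + 1 half-spaces over the 2^d vertices form a critical family of the required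
     size. *)
  have := critical_prod_lattice _ _ d _ _ _ Rn_neq0 (critical_simplex R n).
  case: (helly_numberP R (n + d) _) => [h|]; last by rewrite leey.
  move=> /helly_property_critical /[apply].
  by rewrite card_prod card_option card_ffun card_bool !card_ord lee_fin ler_nat.
Qed.
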